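(* Let $m$ and $n$ be integers greater than $2$. Then $F(C_m \square C_n) \geq \left\lceil \frac{mn}{2} \right\rceil$.
   Context: All graphs are simple, finite and undirected; $C_k$ is the cycle on $k$ vertices. The Cartesian product $G \square H$ has vertex set $V(G)\times V(H)$, with $(u,v)$ adjacent to $(u',v')$ iff either $u=u'$ and $vv'\in E(H)$, or $v=v'$ and $uu'\in E(G)$. Zero forcing: each vertex is blue or white; starting from an initial set $S$ of blue vertices, repeatedly apply the color-change rule: if a blue vertex $u$ has exactly one white neighbor $v$, color $v$ blue. $S$ is a zero forcing set if eventually all vertices are blue, and a failed zero forcing set otherwise. $F(G)$ denotes the maximum cardinality of a failed zero forcing set of $G$. *)

(* Defs.v *)
From mathcomp Require Import all_boot.

Set Implicit Arguments.
Unset Strict Implicit.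
Unset Printing Implicit Defensive.

Record sgraph := SGraph {
  vertex :> finType;
  adj : rel vertex;
  adj_sym : symmetric adj;
  adj_irr : irreflexive adj
}.

(* [ordS] is the successor modulo [k]. The conjunct [i != j] matters only for
   k = 1, where [ordS i = i]; for k >= 3 this is the usual cycle C_k. *)
Definition cycle_rel k : rel 'I_k :=
  fun i j => (i != j) && ((ordS i == j) || (ordS j == i)).

Lemma cycle_rel_sym k : symmetric (@cycle_rel k).
Proof. by move=> i j; rewrite /cycle_rel eq_sym orbC. Qed.

Lemma cycle_rel_irr k : irreflexive (@cycle_rel k).
Proof. by move=> i; rewrite /cycle_rel eqxx. Qed.

Definition cycle_graph k : sgraph :=
  SGraph (@cycle_rel_sym k) (@cycle_rel_irr k).

Definition cart_rel (G H : sgraph) : rel (G * H)%type :=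
  fun x y => ((x.1 == y.1) && adj x.2 y.2) || ((x.2 == y.2) && adj x.1 y.1).

Lemma cart_rel_sym (G H : sgraph) : symmetric (@cart_rel G H).
Proof.
move=> x y; rewrite /cart_rel (eq_sym y.1) (eq_sym y.2).
by rewrite (adj_sym y.1) (adj_sym y.2).
Qed.

Lemma cart_rel_irr (G H : sgraph) : irreflexive (@cart_rel G H).
Proof. by move=> x; rewrite /cart_rel !adj_irr !andbF. Qed.

Definition cart_prod (G H : sgraph) : sgraph :=
  SGraph (@cart_rel_sym G H) (@cart_rel_irr G H).

Section ZeroForcing.
Variable G : sgraph.
Implicit Types (S : {set G}) (u v : G).

Definition white_nbrs S u : {set G} := [set v | adj u v & v \notin S].

(* One application of the color-change rule, where a colouring is identified
   with its set of blue vertices. *)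
Definition color_change : rel {set G} := fun S S' =>
  [exists u in S, exists v, (white_nbrs S u == [set v]) && (S' == v |: S)].

Definition zero_forcing S : bool := connect color_change S [set: G].

(* If G has no vertex then there is no failed set and the value is 0. *)
Definition failed_zero_forcing_number : nat :=
  \max_(S : {set G} | ~~ zero_forcing S) #|S|.

End ZeroForcing.

(* Main.v *)
Require Import Defs.
From mathcomp Require Import all_boot.
From mathcomp Require Import zify.

(** Colour white exactly the vertices whose two coordinates (in [0, m) and
    [0, n)) are both even, and blue all others. Both cyclic neighbours of an odd
    index are even, including across the wrap-around, so a blue vertex with one
    odd coordinate has at least two white neighbours, while a blue vertex with
    two odd coordinates has none. Hence no colour change is possible, and the
    number ceil(m/2) ceil(n/2) of white vertices is at most floor(mn/2). *)

Definition even_ord k : {set 'I_k} := [set i : 'I_k | ~~ odd i].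

Lemma card_even_ord k : #|even_ord k| = uphalf k.
Proof.
rewrite cardsE -sum1_card.
rewrite -(big_mkord (fun i => ~~ odd i) (fun=> 1)).
elim: k => [|k IHk]; first by rewrite big_nil.
rewrite big_mkcond big_nat_recr //= -big_mkcond IHk uphalf_half.
by case: (odd k) => /=; lia.
Qed.

(** The witnesses are [i - 1], which exists since an odd [i] is positive, and [ordS i], which is
    [i + 1] or wraps to [0]. They could coincide only for [k = 2]. *)
Lemma odd_cycle_two_even_nbrs k (i : 'I_k) : 2 < k -> odd i ->
  exists j1 j2 : 'I_k,
    [/\ j1 != j2, j1 \in even_ord k, j2 \in even_ord k,
        cycle_rel i j1 & cycle_rel i j2].
Proof.
move=> k_gt2 odd_i; have lt_ik := ltn_ord i.
have i_gt0 : 0 < i by case: (i : nat) odd_i.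
have lt_pk : i.-1 < k by lia.
have Si : i.+1 %% k = (if i.+1 == k then 0 else i.+1).
  by case: eqP => [->|?]; [rewrite modnn | rewrite modn_small //; lia].
have Sp : ordS (Ordinal lt_pk) == i.
  by rewrite -val_eqE /= prednK // modn_small.
exists (Ordinal lt_pk), (ordS i).
split; rewrite ?inE /cycle_rel ?Sp ?eqxx ?orbT ?andbT -?val_eqE /= ?Si.
all: by try case: (i.+1 =P k); lia.
Qed.

Section Stalled.
Variable G : sgraph.

(** A nonempty [color_change] path from [S] would need a first forcing step, and the empty path ends
    at [S] itself. *)
Lemma stalled_failed (S : {set G}) : S != [set: G] ->
  (forall u v, u \in S -> white_nbrs S u != [set v]) -> ~~ zero_forcing S.
Proof.
move=> SnT stalled; apply/connectP=> -[[|S' p]] /=.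
  by move=> _ TS; rewrite -TS eqxx in SnT.
case/andP=> /exists_inP[u uS /existsP[v /andP[wuv _]]].
by rewrite (negPf (stalled u v uS)) in wuv.
Qed.

Lemma failed_zero_forcing_number_ge (S : {set G}) :
  ~~ zero_forcing S -> #|S| <= failed_zero_forcing_number G.
Proof. exact: (@leq_bigmax_cond _ _ (fun S : {set G} => #|S|)). Qed.

End Stalled.

Definition even_grid m n : {set cart_prod (cycle_graph m) (cycle_graph n)} :=
  setX (even_ord m) (even_ord n).

Lemma card_even_grid m n : #|even_grid m n| = uphalf m * uphalf n.
Proof. by rewrite cardsX !card_even_ord. Qed.

Lemma even_grid_stalled m n u v : 2 < m -> 2 < n ->
  u \in ~: even_grid m n -> white_nbrs (~: even_grid m n) u != [set v].
Proof.
move=> m_gt2 n_gt2; case: u => i j uS; apply/eqP=> wE.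
have inW a b : ((a, b) \in white_nbrs (~: even_grid m n) (i, j)) =
    ((i == a) && cycle_rel j b || (j == b) && cycle_rel i a)
    && (~~ odd a && ~~ odd b) by rewrite !inE negbK.
have W_uniq x y : x \in white_nbrs (~: even_grid m n) (i, j) ->
    y \in white_nbrs (~: even_grid m n) (i, j) -> x = y.
  by rewrite wE !inE => /eqP-> /eqP->.
have : v \in white_nbrs (~: even_grid m n) (i, j) by rewrite wE inE.
case: v {wE} => a b; rewrite inW => /andP[+ /andP[ev_a ev_b]].
(* The white neighbour [(a, b)] shares a coordinate with [(i, j)]. That coordinate is even, so the
   other one is odd because [(i, j)] is blue; moving along it gives two distinct white neighbours,
   against [W_uniq]. *)
case/orP=> /andP[/eqP eq_ _].
- have odd_j : odd j by move: uS; rewrite !inE /= eq_ ev_a /= negbK.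
  have [j1 [j2 [/eqP ne12 e1 e2 adj1 adj2]]] :=
    odd_cycle_two_even_nbrs _ j n_gt2 odd_j.
  rewrite !inE in e1 e2.
  case: ne12; suff [] : (i, j1) = (i, j2) by [].
  by apply: W_uniq; rewrite inW ?e1 ?e2 ?adj1 ?adj2 eqxx eq_ ?ev_a.
- have odd_i : odd i by move: uS; rewrite !inE /= eq_ ev_b andbT negbK.
  have [i1 [i2 [/eqP ne12 e1 e2 adj1 adj2]]] :=
    odd_cycle_two_even_nbrs _ i m_gt2 odd_i.
  rewrite !inE in e1 e2.
  case: ne12; suff [] : (i1, j) = (i2, j) by [].
  by apply: W_uniq; rewrite inW ?e1 ?e2 ?adj1 ?adj2 eqxx eq_ ?ev_b ?orbT.
Qed.

(** The tight case is [m] and [n] both odd, where the inequality amounts to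
    [(m - 1) * (n - 1) >= 4], with equality at [m = n = 3]. *)
Lemma uphalf_mul_le m n : 2 < m -> 2 < n ->
  uphalf m * uphalf n + uphalf (m * n) <= m * n.
Proof.
move=> m_gt2 n_gt2.
have Em := odd_double_half m; have En := odd_double_half n.
have Emn := odd_double_half (m * n); rewrite oddM in Emn.
rewrite !uphalf_half oddM.
move: Em En Emn; case: (odd m); case: (odd n) => /=; rewrite -!muln2; nia.
Qed.

(* [uphalf k] is the ceiling of k / 2. *)
Theorem theorem3p5 (m n : nat) (hm : 2 < m) (hn : 2 < n) :
  uphalf (m * n)
    <= failed_zero_forcing_number (cart_prod (cycle_graph m) (cycle_graph n)).
Proof.
have failS : ~~ zero_forcing (~: even_grid m n).
  apply: stalled_failed => [|u v]; last exact: even_grid_stalled.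
  have [m_gt0 n_gt0] : 0 < m /\ 0 < n by lia.
  (* The vertex [(0, 0)] is white. *)
  apply/eqP=> /setP/(_ (Ordinal m_gt0, Ordinal n_gt0)).
  by rewrite !inE.
apply: leq_trans (failed_zero_forcing_number_ge _ _ failS).
have := cardsC (even_grid m n); rewrite card_prod !card_ord card_even_grid.
by have := uphalf_mul_le m n hm hn; lia.
Qed.
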